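(* Let $A\in BL(X)$ and $\epsilon>0$. Then $$\sigma_{\frac{\epsilon}{\epsilon+2\|A\|}}(A)\subseteq\Lambda_\epsilon(A).$$
   Context: $X$ is a complex Banach space and $BL(X)$ is the Banach algebra of all bounded linear operators on $X$, with identity $I$. The spectrum of $A\in BL(X)$ is $\sigma(A)=\{z\in\mathbb{C}: A-zI \text{ is not invertible}\}$. For $\epsilon>0$ the $\epsilon$-pseudospectrum of $A$ is $$\Lambda_\epsilon(A)=\sigma(A)\cup\{z\in\mathbb{C}: \|(A-zI)^{-1}\|\ge \epsilon^{-1}\}.$$ For $0<\delta<1$ the $\delta$-condition pseudospectrum of $A$ is $$\sigma_\delta(A)=\sigma(A)\cup\{z\in\mathbb{C}: \|A-zI\|\,\|(A-zI)^{-1}\|\ge \delta^{-1}\},$$ and $\sigma_1(A)=\mathbb{C}$.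
   Formalization: The operator A is assumed nonzero: for A = 0 the index is 1 and σ_1(0) = ℂ, while Λ_ε(0) is contained in the disc |z| ≤ ε, so the printed inclusion fails there. *)

(* Defs.v *)
From mathcomp Require Export all_boot all_order all_algebra.
From mathcomp Require Export complex.
From mathcomp Require Export all_classical all_reals all_analysis.
Export Order.TTheory GRing.Theory Num.Theory.
Export numFieldNormedType.Exports.

Set Implicit Arguments.
Unset Strict Implicit.
Unset Printing Implicit Defensive.

Local Open Scope classical_set_scope.
Local Open Scope complex_scope.
Local Open Scope ring_scope.

Section BoundedOperators.
Context {R : realType} {X : completeNormedModType R[i]}.

(* The library's norm on X is R[i]-valued; this is the same norm, read in R. *)
Definition rnorm (x : X) : R := complex.Re `|x|.

Definition bounded_op (T : X -> X) : Prop :=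
  exists M : R, forall x, rnorm (T x) <= M * rnorm x.

Record BL : Type := MkBL {
  BL_fun :> {linear X -> X};
  BL_bounded : bounded_op BL_fun }.

Definition opnorm (T : BL) : R :=
  sup [set rnorm (T x) | x in [set x | rnorm x <= 1]].

Lemma complex_norm_real (z : R[i]) : `|z| = (complex.Re `|z|)%:C.
Proof. by rewrite normc_def. Qed.

Lemma rnormE (x : X) : `|x| = (rnorm x)%:C.
Proof.
have : 0 <= `|x| := normr_ge0 x.
by rewrite /rnorm; case: `|x| => a b; rewrite lecE /= => /andP[/eqP -> _].
Qed.

Lemma rnorm_ge0 (x : X) : 0 <= rnorm x.
Proof. by rewrite -lecR -rnormE normr_ge0. Qed.

Lemma ler_rnormB (x y : X) : rnorm (x - y) <= rnorm x + rnorm y.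
Proof. by rewrite -lecR rmorphD /= -!rnormE ler_normB. Qed.

Lemma rnormZ (z : R[i]) (x : X) :
  rnorm (z *: x) = complex.Re `|z| * rnorm x.
Proof.
apply: complexI.
by rewrite rmorphM /= -!rnormE -complex_norm_real normrZ.
Qed.

Lemma shift_bounded (A : BL) (z : R[i]) :
  bounded_op (A \- (z \*: idfun : X -> X)).
Proof.
case: (BL_bounded A) => M hM; exists (M + complex.Re `|z|) => x /=.
rewrite (le_trans (ler_rnormB _ _))// rnormZ mulrDl.
by rewrite lerD2r hM.
Qed.

(* A - z I *)
Definition BL_shift (A : BL) (z : R[i]) : BL :=
  @MkBL (A \- (z \*: idfun : X -> X)) (shift_bounded A z).

Definition is_inverse (T S : BL) : Prop := cancel T S /\ cancel S T.

Definition invertible (T : BL) : Prop := exists S : BL, is_inverse T S.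

(* As for x^-1 in the library, a non-invertible operator is its own inverse;
   this default is only used at points of the spectrum. *)
Definition BL_inv (T : BL) : BL :=
  if pselect (invertible T) is left h then sval (cid h) else T.

Definition spectrum (A : BL) : set R[i] :=
  [set z | ~ invertible (BL_shift A z)].

Definition pseudospectrum (eps : R) (A : BL) : set R[i] :=
  spectrum A `|` [set z | eps^-1 <= opnorm (BL_inv (BL_shift A z))].

Definition condition_pseudospectrum (delta : R) (A : BL) : set R[i] :=
  if delta == 1 then setT
  else spectrum A `|` [set z |
    delta^-1 <= opnorm (BL_shift A z) * opnorm (BL_inv (BL_shift A z))].

End BoundedOperators.

Arguments BL {R} X.

(* Main.v *)
Require Import Defs.
From mathcomp Require Import lra.

Local Open Scope classical_set_scope.
Local Open Scope complex_scope.
Local Open Scope ring_scope.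

(** With [T = A - zI], the identity [z T^-1 = A T^-1 - I] bounds
    [|z| ||T^-1||] by [||A|| ||T^-1|| + 1]; together with
    [||T|| <= ||A|| + |z|] this gives [||T|| ||T^-1|| <= 2 ||A|| ||T^-1|| + 1],
    so a condition number of at least [1 + 2 ||A|| / eps] forces
    [||T^-1|| >= 1 / eps]. *)

Section OperatorNorm.
Set Implicit Arguments.
Unset Strict Implicit.

Context {R : realType} {X : completeNormedModType R[i]}.
Implicit Types (T S A : BL X) (x : X) (z : R[i]).

Lemma rnorm0 : rnorm (0 : X) = 0.
Proof. by rewrite /rnorm normr0. Qed.

Lemma rnorm_eq0 x : (rnorm x == 0) = (x == 0).
Proof. by rewrite -[RHS]normr_eq0 rnormE (inj_eq (@complexI R)). Qed.

Lemma opnorm_has_sup T :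
  has_sup [set rnorm (T x) | x in [set x | rnorm x <= 1]].
Proof.
split; first by exists (rnorm (T 0)), 0 => //=; rewrite rnorm0 ler01.
have [M TM] := BL_bounded T; exists `|M| => _ [x /= x1 <-].
rewrite (le_trans (TM x))// (le_trans (ler_norm _))// normrM.
by rewrite (ger0_norm (rnorm_ge0 x)) ler_piMr.
Qed.

Lemma opnorm_ge T x : rnorm x <= 1 -> rnorm (T x) <= opnorm T.
Proof.
by move=> x1; apply: ub_le_sup; [case: (opnorm_has_sup T) | exists x].
Qed.

Lemma opnorm_le T (M : R) : 0 <= M ->
  (forall x, rnorm (T x) <= M * rnorm x) -> opnorm T <= M.
Proof.
move=> M0 TM; apply: ge_sup; first by case: (opnorm_has_sup T).
by move=> _ [x /= x1 <-]; rewrite (le_trans (TM x))// ler_piMr.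
Qed.

Lemma opnorm_ge0 T : 0 <= opnorm T.
Proof. by rewrite (le_trans (rnorm_ge0 (T 0)))// opnorm_ge// rnorm0 ler01. Qed.

Lemma rnorm_le_opnorm T x : rnorm (T x) <= opnorm T * rnorm x.
Proof.
have [->|x0] := eqVneq x 0; first by rewrite linear0 rnorm0 mulr0.
have nx0 : 0 < rnorm x by rewrite lt_neqAle eq_sym rnorm_eq0 x0 rnorm_ge0.
have rnormV y : rnorm ((rnorm x)^-1%:C *: y) = rnorm y / rnorm x.
  by rewrite rnormZ ger0_norm ?lecR ?invr_ge0 ?rnorm_ge0//= mulrC.
rewrite -ler_pdivrMr// -rnormV -linearZ opnorm_ge//.
by rewrite rnormV divff ?gt_eqF.
Qed.

Lemma Re_norm_ge0 z : 0 <= complex.Re `|z|.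
Proof. by rewrite -lecR -complex_norm_real normr_ge0. Qed.

Lemma opnorm_shift A z : opnorm (BL_shift A z) <= opnorm A + complex.Re `|z|.
Proof.
apply: opnorm_le => [|x /=]; first by rewrite addr_ge0 ?opnorm_ge0 ?Re_norm_ge0.
by rewrite (le_trans (ler_rnormB _ _))// rnormZ mulrDl lerD2r rnorm_le_opnorm.
Qed.

Lemma norm_opnorm_resolvent A S z : cancel S (BL_shift A z) ->
  complex.Re `|z| * opnorm S <= opnorm A * opnorm S + 1.
Proof.
move=> SK; have [z0|z0] := eqVneq (complex.Re `|z|) 0.
  by rewrite z0 mul0r addr_ge0// mulr_ge0 ?opnorm_ge0.
have {}z0 : 0 < complex.Re `|z| by rewrite lt_neqAle eq_sym z0 Re_norm_ge0.
rewrite mulrC -ler_pdivlMr//; apply: opnorm_le => [|x].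
  by rewrite divr_ge0 ?addr_ge0 ?mulr_ge0 ?opnorm_ge0 ?Re_norm_ge0.
rewrite mulrAC ler_pdivlMr// mulrC -rnormZ.
have -> : z *: S x = A (S x) - x by rewrite -[X in _ - X]SK /= opprB addrC subrK.
rewrite (le_trans (ler_rnormB _ _))// mulrDl mul1r lerD2r.
rewrite (le_trans (rnorm_le_opnorm _ _))// -mulrA.
by rewrite ler_wpM2l ?opnorm_ge0 ?rnorm_le_opnorm.
Qed.

Lemma condition_number_shift_le A S z : cancel S (BL_shift A z) ->
  opnorm (BL_shift A z) * opnorm S <= 1 + 2 * opnorm A * opnorm S.
Proof.
move=> SK; have := ler_wpM2r (opnorm_ge0 S) (opnorm_shift A z).
by have := norm_opnorm_resolvent SK; lra.
Qed.

Lemma opnorm_gt0 A : (exists x, A x != 0) -> 0 < opnorm A.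
Proof.
move=> [x Ax0]; rewrite lt_neqAle opnorm_ge0 andbT eq_sym.
apply: contraNneq Ax0 => A0; rewrite -rnorm_eq0 eq_le rnorm_ge0 andbT.
by rewrite (le_trans (rnorm_le_opnorm A x))// A0 mul0r.
Qed.

Lemma BL_invP T : invertible T -> is_inverse T (BL_inv T).
Proof. by rewrite /BL_inv; case: pselect => // h _; case: cid. Qed.

End OperatorNorm.

Theorem lemma4p4 (R : realType) (X : completeNormedModType R[i])
    (A : BL X) (eps : R)
    (A_neq0 : exists x : X, A x != 0) (eps_gt0 : 0 < eps) :
  condition_pseudospectrum (eps / (eps + 2 * opnorm A)) A
    `<=` pseudospectrum eps A.
Proof.
have A2_gt0 : 0 < 2 * opnorm A by rewrite mulr_gt0 ?opnorm_gt0.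
have delta_lt1 : eps / (eps + 2 * opnorm A) < 1.
  by rewrite ltr_pdivrMr ?addr_gt0// mul1r ltrDl.
rewrite /condition_pseudospectrum lt_eqF// => z [|/= cond]; first by left.
have [inv_z|] := pselect (invertible (BL_shift A z)); last by left.
right => /=; have [_ /condition_number_shift_le/(le_trans cond)] := BL_invP inv_z.
by rewrite invf_div mulrDl divff ?gt_eqF// lerD2l ler_pM2l.
Qed.
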